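(* Let $1\le s\leq \ell$ be integers, let $f\in\mathcal{L}(G)$ be the sent message, let $\boldsymbol{r}=\boldsymbol{c}+\boldsymbol{e}$ be the received word, where $\boldsymbol{c}=(f(P_1),\dots,f(P_n))$ and $\boldsymbol{e}\in\mathbb{F}^n$, let $R$ be an $\boldsymbol{r}$-interpolator of degree $\rho$, and let $\Lambda_s$ be an error locator (for $\boldsymbol{e}$) with multiplicity $s$ and degree $\lambda_s$. Then for every $t=1,\dots,\ell$, \[ \Lambda_s f^t-\sum_{j=0}^{\min\{t,s-1\}}\binom{t}{j}\Lambda_s(f-R)^jR^{t-j}\in \begin{cases} \{0\} & \text{if } 1\leq t\leq s-1,\\ \mathcal{L}(Q_t-sD) & \text{if } s\leq t\leq\ell. \end{cases} \]
   Context: Let $F$ be an algebraic function field of genus $g$ over a base field $\mathbb{F}$, and let $P_1,\dots,P_n,P_\infty$ be pairwise distinct rational places of $F$. Let $D=P_1+\cdots+P_n$ and let $G$ be a divisor with $\operatorname{supp}G\cap\operatorname{supp}D=\emptyset$. For a divisor $A$, $\mathcal{L}(A)=\{h\in F\setminus\{0\} : (h)\geq -A\}\cup\{0\}$. For $\boldsymbol{r}=(r_1,\dots,r_n)\in\mathbb{F}^n$, an $\boldsymbol{r}$-interpolator of degree $\rho$ is an element $R\in\mathcal{L}(G+\rho P_\infty)$ with $R\notin\mathcal{L}(G+(\rho-1)P_\infty)$ and $R(P_i)=r_i$ for $i=1,\dots,n$. For $\boldsymbol{e}=(e_1,\dots,e_n)$ put $\mathcal{E}=\{i: e_i\ne0\}$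 and $E=\sum_{i\in\mathcal{E}}P_i$. An error locator with multiplicity $s$ and degree $\lambda_s$ is an element $\Lambda_s\in\mathcal{L}(\lambda_sP_\infty-sE)$ with $\Lambda_s\notin\mathcal{L}((\lambda_s-1)P_\infty-sE)$. For $t=1,\dots,\ell$, $Q_t=\lambda_sP_\infty+t(G+\rho P_\infty)$. Binomial coefficients are interpreted in $\mathbb{F}$.
   Formalization: The interpolator degree ρ is taken to be nonnegative; for negative ρ the claim can fail at P_∞ (for example F=𝔽(x), G=P_∞, f=x, R=1, ρ=−1, Λ_1=x, n=s=ℓ=t=1), since L(G) need not lie in L(G+ρP_∞). *)

(* Defs.v *)
(* MathComp, with classical sets and choice from MathComp-Analysis ([boolp],
   [classical_sets]) and formal sums [{freeg _ / int}] from multinomials. *)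
From HB Require Import structures.
From mathcomp Require Import all_boot all_order all_algebra.
From mathcomp Require Import boolp classical_sets.
From mathcomp.multinomials Require Import freeg.

Set Implicit Arguments.
Unset Strict Implicit.
Unset Printing Implicit Defensive.

Import Order.TTheory GRing.Theory Num.Theory.

Local Open Scope classical_set_scope.
Local Open Scope ring_scope.

(* A field extension F/K is given by the embedding iota of the base field K in
   F, since [fieldExtType] only covers extensions of finite degree. *)

Definition rational_in (K F : fieldType) (iota : {rmorphism K -> F}) (x : F) :
    set F :=
  [set z | exists p q : {poly K},
     (map_poly iota q).[x] != 0 /\
     z = (map_poly iota p).[x] / (map_poly iota q).[x]].

(* F/K is an algebraic function field of one variable: F is a finite extension
   of K(x) for some x in F transcendental over K. *)
Definition function_field (K F : fieldType) (iota : {rmorphism K -> F}) : Prop :=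
  exists x : F, ~ algebraicOver iota x /\
    exists (d : nat) (b : 'I_d -> F), forall z : F,
      exists2 c : 'I_d -> F,
        forall i, rational_in iota x (c i) & z = \sum_(i < d) c i * b i.

(* A place is represented by its normalized discrete valuation, which is trivial
   on K.  The valuation of 0 should be +oo; [pval] takes the junk value 0 there,
   so that two places are equal exactly when their valuations agree, and 0 is
   treated separately in every definition below. *)
Record place (K F : fieldType) (iota : {rmorphism K -> F}) := Place {
  pval : F -> int;
  pval0 : pval 0 = 0;
  pvalM : forall x y, x != 0 -> y != 0 -> pval (x * y) = pval x + pval y;
  pvalD : forall x y, x != 0 -> y != 0 -> x + y != 0 ->
            Num.min (pval x) (pval y) <= pval (x + y);
  pval_const : forall a : K, a != 0 -> pval (iota a) = 0;
  pval_surj : exists2 z, z != 0 & pval z = 1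
}.

HB.instance Definition _ (K F : fieldType) (iota : {rmorphism K -> F}) :=
  gen_eqMixin (place iota).
HB.instance Definition _ (K F : fieldType) (iota : {rmorphism K -> F}) :=
  gen_choiceMixin (place iota).

Notation divisor iota := {freeg (place iota) / int}.

Section FunctionField.
Variables (K F : fieldType) (iota : {rmorphism K -> F}).
Implicit Types (P Q : place iota) (A : divisor iota).

Definition valuation_ring P : set F := [set z | z = 0 \/ 0 <= pval P z].

Definition maximal_ideal P : set F := [set z | z = 0 \/ 0 < pval P z].

(* For K-subspaces W of V, the quotient V / W has dimension d: the classes of
   some b_0, ..., b_(d-1) in V form a basis of it. *)
Definition has_dim_quotient (V W : set F) (d : nat) : Prop :=
  exists2 b : 'I_d -> F, forall i, V (b i) &
    forall z, V z -> exists! c : {ffun 'I_d -> K},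
      W (z - \sum_(i < d) iota (c i) * b i).

(* The dimension of V / W over K, with junk value 0 when it is infinite. *)
Definition dim_quotient (V W : set F) : nat :=
  xget 0%N [set d | has_dim_quotient V W d].

Definition place_degree P : nat :=
  dim_quotient (valuation_ring P) (maximal_ideal P).

Definition rational_place P : Prop := place_degree P = 1%N.

(* The value h(P) in K of h at a rational place P, i.e. the residue class of h,
   with junk value 0 when h is not in the valuation ring of P. *)
Definition eval_at P (h : F) : K :=
  xget 0 [set a | maximal_ideal P (h - iota a)].

Definition divisor_degree A : int :=
  \sum_(Q <- dom A) coeff Q A * (place_degree Q)%:Z.

(* L(A); the condition (h) >= - A is read coefficient by coefficient, the
   coefficient of the principal divisor (h) at Q being v_Q(h). *)
Definition RRspace A : set F :=
  [set h | h != 0 /\ forall Q, - coeff Q A <= pval Q h] `|` [set 0].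

Definition RRdim A : nat := dim_quotient (RRspace A) [set 0].

(* g is the maximum of deg A - l(A) + 1 over all divisors A. *)
Definition has_genus (g : nat) : Prop :=
  (exists A, divisor_degree A - (RRdim A)%:Z + 1 = g%:Z) /\
  (forall A, divisor_degree A - (RRdim A)%:Z + 1 <= g%:Z).

(* The degree of an interpolator is a natural number, so that L(G) is contained
   in L(G + rho Pinf); the difference rho - 1 is taken in int. *)
Definition is_interpolator (n : nat) (P : 'I_n -> place iota)
    (Pinf : place iota) (G : divisor iota) (r : 'rV[K]_n) (rho : nat) (R : F) :
    Prop :=
  [/\ R \in RRspace (G + << rho%:Z *g Pinf >>),
      R \notin RRspace (G + << rho%:Z - 1 *g Pinf >>)
    & forall i, eval_at (P i) R = r 0 i].

Definition error_divisor (n : nat) (P : 'I_n -> place iota) (e : 'rV[K]_n) :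
    divisor iota :=
  \sum_(i < n | e 0 i != 0) << P i >>.

Definition is_error_locator (n : nat) (P : 'I_n -> place iota)
    (Pinf : place iota) (e : 'rV[K]_n) (s : nat) (lambda : int) (Lam : F) :
    Prop :=
  Lam \in RRspace (<< lambda *g Pinf >> - error_divisor P e *+ s) /\
  Lam \notin RRspace (<< lambda - 1 *g Pinf >> - error_divisor P e *+ s).

End FunctionField.

(* Main.v *)
(* Expanding [f ^+ t = (R + (f - R)) ^+ t] by the binomial theorem, the difference
   is the tail of the sum, over [s <= j <= t].  The pole orders of its terms are
   bounded by Q_t because f and R both lie in L(G + rho Pinf).  Each term vanishes to
   order s at P_i: if [e_i != 0] thanks to Lam, and otherwise because f and R
   have the same value there, so that f - R, which occurs to a power [j >= s],
   vanishes at P_i. *)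
Require Import Defs.
From mathcomp Require Import all_boot all_order all_algebra.
From mathcomp Require Import boolp classical_sets.
From mathcomp.multinomials Require Import freeg.
From mathcomp Require Import zify ring.

Import Order.TTheory GRing.Theory Num.Theory.
Local Open Scope classical_set_scope.
Local Open Scope ring_scope.

Set Implicit Arguments.
Unset Strict Implicit.
Unset Printing Implicit Defensive.

Section Order.
Variables (K F : fieldType) (iota : {rmorphism K -> F}) (P : place iota).

(* The convention [pval P 0 = +oo]. *)
Definition val_ge (m : int) (h : F) : Prop := h = 0 \/ m <= pval P h.

Lemma val_ge0 m : val_ge m 0.
Proof. by left. Qed.

Lemma val_geW m m' h : m' <= m -> val_ge m h -> val_ge m' h.
Proof. by move=> le_m [->|h_ge]; [left | right; apply: le_trans h_ge]. Qed.

Lemma val_geD m x y : val_ge m x -> val_ge m y -> val_ge m (x + y).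
Proof.
have [->|x0] := eqVneq x 0; first by rewrite add0r.
have [->|y0] := eqVneq y 0; first by rewrite addr0.
case=> [/eqP|hx]; first by rewrite (negPf x0).
case=> [/eqP|hy]; first by rewrite (negPf y0).
have [->|xy0] := eqVneq (x + y) 0; first by left.
by right; apply: le_trans (pvalD P x0 y0 xy0); rewrite le_min hx.
Qed.

Lemma val_geM m m' x y : val_ge m x -> val_ge m' y -> val_ge (m + m') (x * y).
Proof.
have [->|x0] := eqVneq x 0; first by rewrite mul0r; left.
have [->|y0] := eqVneq y 0; first by rewrite mulr0; left.
case=> [/eqP|hx]; first by rewrite (negPf x0).
case=> [/eqP|hy]; first by rewrite (negPf y0).
by right; rewrite pvalM // lerD.
Qed.

Lemma val_ge_const a : val_ge 0 (iota a).
Proof.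
have [->|a0] := eqVneq a 0; first by rewrite rmorph0; left.
by right; rewrite pval_const.
Qed.

Lemma val_geN m x : val_ge m x -> val_ge m (- x).
Proof.
by move=> hx; rewrite -mulN1r -(rmorph1 iota) -rmorphN -[m]add0r;
  apply: val_geM => //; apply: val_ge_const.
Qed.

Lemma val_geB m x y : val_ge m x -> val_ge m y -> val_ge m (x - y).
Proof. by move=> hx hy; apply/val_geD/val_geN. Qed.

Lemma val_geX m x k : val_ge m x -> val_ge (m *+ k) (x ^+ k).
Proof.
move=> hx; elim: k => [|k IHk]; last by rewrite exprS mulrS; apply: val_geM.
by rewrite expr0 -(rmorph1 iota); apply: val_ge_const.
Qed.

Lemma val_ge_sum (I : eqType) (m : int) (r : seq I) (E : I -> F) :
  {in r, forall i, val_ge m (E i)} -> val_ge m (\sum_(i <- r) E i).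
Proof.
move=> hE; rewrite big_seq; apply: (big_ind (val_ge m)) => //.
  exact: val_ge0.
exact: val_geD.
Qed.

Lemma maximal_idealP h : maximal_ideal P h <-> val_ge 1 h.
Proof. by rewrite /maximal_ideal /val_ge /= -gtz0_ge1. Qed.

Lemma not_val_ge1_one : ~ val_ge 1 1.
Proof.
case=> [/eqP|]; first by rewrite oner_eq0.
by rewrite -(rmorph1 iota) pval_const ?oner_eq0.
Qed.

(** The one-element basis of the residue field over [K] supplied by degree 1 need not be the class
    of 1. Expressing both [h] and 1 in this basis and dividing the coordinates gives the residue of
    [h] as a constant. *)
Lemma rational_place_residue h : rational_place P -> val_ge 0 h ->
  exists a, val_ge 1 (h - iota a).
Proof.
rewrite /rational_place /place_degree /dim_quotient.
(* The junk dimension 0 differs from 1, so a genuine basis exists. *)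
case: xgetP => // d -> [b hb quot] d1 hh; rewrite {d}d1 in b hb quot.
have residue z : val_ge 0 z -> exists a, val_ge 1 (z - iota a * b ord0).
  move=> /quot [c [/maximal_idealP hc _]].
  by exists (c ord0); rewrite big_ord1 in hc.
have [a ha] := residue h hh.
have [u hu] : exists u, val_ge 1 (1 - iota u * b ord0).
  by apply: residue; rewrite -(rmorph1 iota); apply: val_ge_const.
(* Otherwise 1 itself would lie in the maximal ideal. *)
have u0 : iota u != 0.
  by apply/eqP => u0; apply: not_val_ge1_one; rewrite u0 mul0r subr0 in hu.
exists (a / u).
have -> : h - iota (a / u) =
    (h - iota a * b ord0) - iota (a / u) * (1 - iota u * b ord0).
  by rewrite rmorphM /= fmorphV; field.
by apply: val_geB => //; rewrite -[1]add0r; apply: val_geM => //;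
  apply: val_ge_const.
Qed.

(** A residue exists, so the default value of [eval_at] is never taken. *)
Lemma eval_atP h : rational_place P -> val_ge 0 h ->
  val_ge 1 (h - iota (eval_at P h)).
Proof.
move=> Prat /(rational_place_residue Prat)[a /maximal_idealP ha].
by apply/maximal_idealP; rewrite /eval_at; case: xgetP => [b _ //|/(_ a)].
Qed.

Lemma eval_at_eq_sub x y : rational_place P -> val_ge 0 x -> val_ge 0 y ->
  eval_at P x = eval_at P y -> val_ge 1 (x - y).
Proof.
move=> Prat hx hy exy.
have -> : x - y = (x - iota (eval_at P x)) - (y - iota (eval_at P y)).
  by rewrite exy; ring.
by apply: val_geB; apply: eval_atP.
Qed.

End Order.

(** Giving 0 infinite order absorbs its separate case in [RRspace], so membership can be checked one
    place at a time. *)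
Lemma RRspaceP (K F : fieldType) (iota : {rmorphism K -> F})
    (A : divisor iota) (h : F) :
  (h \in RRspace A) <-> forall Q, val_ge Q (- coeff Q A) h.
Proof.
rewrite in_setE; split=> [[[_ hA] Q|->] | hA]; [by right | by left |].
have [->|h0] := eqVneq h 0; [by right | left; split=> // Q].
by case: (hA Q) => // /eqP; rewrite (negPf h0).
Qed.

Lemma coeff_sum_places (K F : fieldType) (iota : {rmorphism K -> F})
    (n : nat) (P : 'I_n -> place iota) (p : pred 'I_n) (i : 'I_n) :
  injective P -> coeff (P i) (\sum_(k < n | p k) << P k >> : divisor iota) = (p i)%:R.
Proof.
move=> Pinj; rewrite raddf_sum /=.
under eq_bigr do rewrite coeffU mul1r (inj_eq Pinj).
case pi: (p i).
  rewrite (bigD1 i) //= eqxx big1 ?addr0 // => k /andP[_ /negPf->] //.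
by rewrite big1 // => k; case: eqP => // ->; rewrite pi.
Qed.

Lemma coeff_sum_places_notin (K F : fieldType) (iota : {rmorphism K -> F})
    (n : nat) (P : 'I_n -> place iota) (p : pred 'I_n) (Q : place iota) :
  (forall i, P i <> Q) -> coeff Q (\sum_(k < n | p k) << P k >> : divisor iota) = 0.
Proof.
move=> PQ; rewrite raddf_sum /= big1 // => k _.
by rewrite coeffU; case: eqP => [/PQ|]; rewrite ?mulr0.
Qed.

(** The full binomial expansion of [x = y + (x - y)] is cut at [s]. If [t < s], the subtracted sum
    is already the whole expansion and the tail is empty. Since [s] is positive, the truncated
    [s - 1] has successor [s]. *)
Lemma binomial_tail (A : comPzRingType) (a x y : A) (s t : nat) : (1 <= s)%N ->
  a * x ^+ t
    - \sum_(0 <= j < (minn t (s - 1)).+1)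
        'C(t, j)%:R * a * (x - y) ^+ j * y ^+ (t - j)
  = \sum_(s <= j < t.+1) 'C(t, j)%:R * a * (x - y) ^+ j * y ^+ (t - j).
Proof.
move=> s_gt0.
have -> : a * x ^+ t
    = \sum_(0 <= j < t.+1) 'C(t, j)%:R * a * (x - y) ^+ j * y ^+ (t - j).
  rewrite -{1}[x](subrKC y) exprDn mulr_sumr big_mkord.
  by apply: eq_bigr => j _; rewrite -mulr_natl; ring.
have [lt_ts|le_st] := ltnP t s.
  by rewrite (minn_idPl _) ?subrr ?big_geq //; lia.
rewrite (minn_idPr _); last by lia.
rewrite (_ : (s - 1).+1 = s); last by lia.
by rewrite (big_cat_nat (n := s)) //= 1?leqW // addrAC subrr add0r.
Qed.

Unset Implicit Arguments.
Set Strict Implicit.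

Theorem mainTheorem3 (K F : fieldType) (iota : {rmorphism K -> F})
  (hF : function_field iota) (g : nat) (hg : has_genus iota g)
  (n : nat) (P : 'I_n -> place iota) (Pinf : place iota)
  (hPinj : injective P) (hPinf : forall i, P i <> Pinf)
  (hPrat : forall i, rational_place (P i)) (hPinfrat : rational_place Pinf)
  (D : divisor iota) (hD : D = \sum_(i < n) << P i >>)
  (G : divisor iota)
  (hG : forall Q : place iota, ~ (Q \in dom G /\ Q \in dom D))
  (s l : nat) (hs : (1 <= s)%N) (hsl : (s <= l)%N)
  (f : F) (hf : f \in RRspace G)
  (c e r : 'rV[K]_n)
  (hc : c = \row_(i < n) eval_at (P i) f) (hr : r = c + e)
  (rho : nat) (R : F) (hR : is_interpolator P Pinf G r rho R)
  (lambda : int) (Lam : F) (hLam : is_error_locator P Pinf e s lambda Lam)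
  (Q : nat -> divisor iota)
  (hQ : forall t, (1 <= t <= l)%N ->
          Q t = << lambda *g Pinf >> + (G + << rho%:Z *g Pinf >>) *+ t)
  (t : nat) (ht : (1 <= t <= l)%N) :
  Lam * f ^+ t
    - \sum_(0 <= j < (minn t (s - 1)).+1)
        iota ('C(t, j)%:R) * Lam * (f - R) ^+ j * R ^+ (t - j)
  \in (if (t <= s - 1)%N then [set 0] else RRspace (Q t - D *+ s)).
Proof.
under eq_bigr do rewrite rmorph_nat.
rewrite binomial_tail //.
case: leqP => [le_ts|lt_st]; first by rewrite big_geq ?mem_set //; lia.
apply/RRspaceP => Q0; apply: val_ge_sum => j; rewrite mem_index_iota ltnS.
case/andP=> le_sj le_jt.
have [/RRspaceP hRR _ evR] := hR.
have [/RRspaceP hL _] := hLam.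
move/RRspaceP in hf.
rewrite hQ // -!mulrA.
(* The binomial coefficient may vanish in [F], but as a constant it never lowers the order. *)
have hbin : val_ge Q0 0 'C(t, j)%:R.
  by rewrite -(rmorph_nat iota); apply: val_ge_const.
rewrite -[- coeff _ _]add0r; apply: val_geM => //.
have [[i PiQ]|noti] := pselect (exists i, P i = Q0).
  rewrite -{}PiQ {Q0 hbin}.
  have cD : coeff (P i) D = 1 by rewrite hD (coeff_sum_places xpredT).
  (* [P i] lies in the support of [D], which is disjoint from that of [G]. *)
  have cG : coeff (P i) G = 0.
    apply/eqP; apply: contrapT => /negP cG; apply: (hG (P i)).
    by rewrite !mem_dom cD.
  have cinf m : coeff (P i) << m *g Pinf >> = 0.
    by rewrite coeffU; case: eqP => [/esym/hPinf|]; rewrite ?mulr0.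
  have f_ge0 : val_ge (P i) 0 f by have := hf (P i); rewrite cG oppr0.
  have R_ge0 : val_ge (P i) 0 R.
    by have := hRR (P i); rewrite coeffD cG cinf addr0 oppr0.
  rewrite !(coeffB, coeffD, coeffMn) cG !cinf cD.
  have {}hL : val_ge (P i) ((e 0 i != 0)%:R *+ s) Lam.
    have := hL (P i).
    by rewrite coeffB coeffMn cinf coeff_sum_places // sub0r opprK.
  (* Neither [G] nor [Pinf] contributes at [P i]: the order to reach is exactly [s]. *)
  rewrite addr0 mul0rn addr0 sub0r opprK.
  have R_X : val_ge (P i) 0 (R ^+ (t - j)).
    by have := val_geX (t - j) R_ge0; rewrite mul0rn.
  (* At an error position [Lam] supplies the whole order [s]; elsewhere the power of [f - R]
     does. *)
  have [ei|ei] := eqVneq (e 0 i) 0; last first.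
    rewrite ei in hL; rewrite -[1 *+ s]addr0; apply: val_geM => //.
    rewrite -[0]addr0; apply: val_geM => //.
    by have := val_geX j (val_geB f_ge0 R_ge0); rewrite mul0rn.
  rewrite ei eqxx mul0rn in hL; rewrite -[1 *+ s]add0r; apply: val_geM => //.
  rewrite -[1 *+ s]addr0; apply: val_geM => //.
  have fR : val_ge (P i) 1 (f - R).
    apply: eval_at_eq_sub => //.
    by rewrite evR hr hc !mxE ei addr0.
  (* The order is at least [j], and [s <= j] in the tail. *)
  by apply: val_geW (val_geX j fR); rewrite ler_nat.
(* Off the support of [D] only the pole bound of [Q t] remains. *)
have PQ i : P i <> Q0 by move=> PiQ; apply: noti; exists i.
have := hL Q0.
rewrite !(coeffB, coeffD, coeffMn) hD !coeff_sum_places_notin //.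
rewrite mul0rn !subr0 opprD => {}hL; apply: val_geM => //.
have := hRR Q0; rewrite coeffD; set m := _ + _ => R_ge.
(* As [rho] is nonnegative, the bound for [R] also holds for [f], hence for [f - R]. *)
have f_ge : val_ge Q0 (- m) f.
  apply: val_geW (hf Q0); rewrite lerN2 /m lerDl coeffU.
  by apply: mulr_ge0; rewrite ?ler0n.
(* The [t] copies of the bound are shared out: [j] to the factors [f - R] and [t - j] to the factors
   [R]. *)
rewrite -mulNrn -(subnKC le_jt) mulrnDr addKn.
by apply: val_geM; apply: val_geX => //; apply: val_geB.
Qed.
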